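(* Every standard multigraph $M$ on $n$ vertices with $\delta(M)\geq\frac{4n-3}{3}$ contains $\lfloor\frac{n}{3}\rfloor$ pairwise vertex-disjoint $4$-triangles.
   Context: Multigraphs have no loops; $\mu(x,y)$ is the number of edges with ends $x,y$; $M$ is standard if $\mu(x,y)\le2$ for all $x,y$; $d(x)=\sum_y\mu(x,y)$ and $\delta(M)=\min_x d(x)$. A $4$-triangle is a multigraph on three vertices containing a triangle $C_3$ and having exactly $4$ edges counted with multiplicity; $M$ contains a $4$-triangle on $\{x,y,z\}$ iff $x,y,z$ are pairwise adjacent and $\mu(x,y)+\mu(y,z)+\mu(x,z)\ge4$. *)

(* Defs.v *)
From mathcomp Require Import all_boot.

Set Implicit Arguments.
Unset Strict Implicit.
Unset Printing Implicit Defensive.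

(* Loopless multigraphs on the vertex type V. *)
Record multigraph (V : finType) := Multigraph {
  mu :> V -> V -> nat;
  mu_sym : forall x y, mu x y = mu y x;
  mu_loopless : forall x, mu x x = 0 }.

Section Multigraph.

Variables (V : finType) (M : multigraph V).

Definition standard : Prop := forall x y : V, M x y <= 2.

Definition adjacent (x y : V) : bool := 0 < M x y.

Definition degree (x : V) : nat := \sum_(y : V) M x y.

(* The maximum degree is only the starting value of the iterated minimum: it is
   absorbed as soon as V is inhabited, and it is 0 when V is empty. *)
Definition min_degree : nat :=
  \big[minn/(\max_(x : V) degree x)]_(x : V) degree x.

(* x, y, z are automatically distinct, since adjacent vertices are. *)
Definition contains_4triangle_on (T : {set V}) : Prop :=
  exists x y z : V,
    [/\ T = [set x; y; z],
        [&& adjacent x y, adjacent y z & adjacent x z]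
      & 4 <= M x y + M y z + M x z].

(* A 4-triangle has exactly three vertices, so vertex-disjoint 4-triangles
   have distinct nonempty vertex sets, and a family of k of them amounts to a
   set of k such vertex sets. *)
Definition contains_disjoint_4triangles (k : nat) : Prop :=
  exists P : {set {set V}},
    [/\ #|P| = k, trivIset P & forall T, T \in P -> contains_4triangle_on T].

End Multigraph.

(* Main.v *)
(* Once M is partitioned into triangles, a triangle of weight 3 sends at least
   13 edges to some other triangle; then a vertex of the former sending at least
   5 edges to the latter can be exchanged for a vertex of the latter so that both
   triangles become 4-triangles.  Triangle partitions come from the
   Hajnal-Szemeredi theorem applied to the complement of the underlying graph,
   proved following Kierstead and Kostochka: an equitable colouring is disturbed
   by adding the edges at one vertex, and repaired by shifting vertices along
   paths of colour classes towards the deficient class, or else by an exchange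
   that enlarges the set of classes from which the deficient one can be reached.
   If n = 1 mod 3, one vertex is discarded; if n = 2 mod 3, a vertex doubly
   joined to all others is added. *)

Require Import Defs.
From mathcomp Require Import all_boot all_order all_algebra.
From mathcomp Require Import zify.
Import Order.TTheory GRing.Theory Num.Theory.

Set Implicit Arguments.
Unset Strict Implicit.
Unset Printing Implicit Defensive.

(** * Paths towards a target in a digraph, and vertices that cut them *)

Lemma path_arcs_sub (T : eqType) (r r' : rel T) (x : T) (p : seq T) :
  (forall u v, u \in x :: p -> v \in p -> r u v -> r' u v) ->
  path r x p -> path r' x p.
Proof.
elim: p x => //= y p IH x rr' /andP[rxy pathp]; apply/andP; split.
  by apply: rr' rxy; rewrite mem_head.
by apply: IH pathp => u v uP vP; apply: rr'; rewrite inE ?uP ?vP orbT.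
Qed.

Section TerminalVertices.

Variables (C : finType) (r : rel C) (a : C).

Definition accessible : {set C} := [set c | connect r c a].

Definition avoid w : rel C := fun u v => [&& r u v, u != w & v != w].

Definition cut_off w : {set C} :=
  [set x in accessible | (x != w) && ~~ connect (avoid w) x a].

Lemma path_avoid w x p : path r x p -> w \notin x :: p -> path (avoid w) x p.
Proof.
move=> pathp wNp; apply: path_arcs_sub pathp => u v uP vP ruv; rewrite /avoid ruv /=.
by apply/andP; split; apply: contraNneq wNp => <- //; rewrite inE vP orbT.
Qed.

Lemma path_accessible x p : path r x p -> last x p = a -> {subset x :: p <= accessible}.
Proof.
elim: p x => [|y p IH] x /=.
  by move=> _ xa u; rewrite !inE => /eqP ->; rewrite xa connect0.
case/andP=> rxy pathp lastp; have {}IH := IH _ pathp lastp.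
move=> u; rewrite inE => /predU1P[->|]; last exact: IH.
have := IH y (mem_head _ _); rewrite !inE; apply: connect_trans.
exact: connect1.
Qed.

Lemma connect_avoidP w x : connect (avoid w) x a ->
  exists p, [/\ path (avoid w) x p, uniq (x :: p), last x p = a
              & {subset x :: p <= accessible}].
Proof.
case/connectP => p /shortenP[q pathq uq _] lastq; exists q; split=> //.
by apply: path_accessible (esym lastq); apply: sub_path pathq => u v /and3P[].
Qed.

(** Every path from [x] to [a] runs through [w], and what follows [w] runs through [U]. *)
Lemma cut_off_subset U w : w \in cut_off U -> cut_off w \subset cut_off U.
Proof.
rewrite inE => /and3P[accw wU NUw]; apply/subsetP => x; rewrite !inE.
case/and3P=> accx xw Nwx; rewrite accx /=.
have hit p : path r x p -> last x p = a -> w \in x :: p.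
  move=> pathp lastp; apply: contraNT Nwx => wNp; apply/connectP.
  by exists p => //; apply: path_avoid.
(* The case [x = U] is impossible: on a simple path from [U] the part after [w] avoids [U], although
   [U] separates [w] from [a]. *)
have [xU|xU] := eqVneq x U.
  case/connectP: accx => p /shortenP[q pathq uq _] /esym lastq.
  have wq := hit q pathq lastq.
  move: uq pathq lastq; case/splitPl: q / wq => q1 q2 lastq1 uq.
  rewrite cat_path last_cat lastq1 => /andP[_ pathq2] lastq2.
  case/negP: NUw; apply/connectP; exists q2 => //; apply: path_avoid => //.
  rewrite inE eq_sym (negPf wU) /= -xU.
  by move: uq; rewrite /= mem_cat negb_or => /andP[/andP[]].
apply: contra NUw => /connectP[p pathp /esym lastp].
have wp : w \in x :: p by apply: hit lastp; apply: sub_path pathp => u v /and3P[].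
move: pathp lastp; case/splitPl: p / wp => p1 p2 lastp1.
rewrite cat_path last_cat lastp1 => /andP[_ pathp2] lastp2.
by apply/connectP; exists p2.
Qed.

(* W is a set of vertices cut off by a vertex U, of minimal size: then no vertex
   of W is itself a cut, and the only way out of W is through U. *)
Lemma exists_minimal_cut : 1 < #|accessible| -> exists (W : {set C}) (U : C),
  [/\ W != set0, W \subset accessible, a \notin W, U \in accessible /\ U \notin W
    & {in W, forall w, {in accessible, forall x,
        (x != w -> connect (avoid w) x a) /\
        (x \notin W -> x != U -> ~~ r w x)}}].
Proof.
move=> acc_gt1.
have acca : a \in accessible by rewrite inE.
pose P U := (U \in accessible) && (cut_off U != set0).
(* The target itself cuts off every other accessible vertex, so the minimum below ranges over a
   nonempty family. *)
have Pa : P a.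
  rewrite /P acca /=; have /card_gt1P[x [y [accx accy xy]]] := acc_gt1.
  have [z accz za] : exists2 z, z \in accessible & z != a.
    by have [xa|xa] := eqVneq x a; [exists y => //; rewrite -xa eq_sym | exists x].
  apply/set0Pn; exists z; rewrite inE accz za /=; apply/connectP => -[p pathp lastp].
  elim/last_ind: p pathp lastp => [_ /= az|p b _]; first by rewrite az eqxx in za.
  rewrite rcons_path last_rcons => /andP[_ /and3P[_ _ ba]] ab.
  by rewrite ab eqxx in ba.
case: (arg_minnP (fun U => #|cut_off U|) Pa) => U /andP[accU cutU] minU.
exists (cut_off U), U; split=> //.
- by apply/subsetP => x; rewrite inE => /and3P[].
- by rewrite inE connect0 !andbF.
- by rewrite accU inE eqxx andbF.
move=> w wU x accx; split=> [xw | xNU xU].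
  (* If [w] cut off some [x], its cut-off set would be nonempty and strictly smaller, since it omits
     [w]. *)
  apply: contraT => Nwx.
  have accw : w \in accessible by move: wU; rewrite inE => /and3P[].
  have Pw : P w by rewrite /P accw; apply/set0Pn; exists x; rewrite inE accx xw.
  have := minU w Pw; rewrite leqNgt proper_card // properE cut_off_subset //=.
  by apply/subsetPn; exists w => //; rewrite inE eqxx andbF.
apply: contra xNU => rwx; move: wU; rewrite !inE => /and3P[_ wU NUw].
move: accx; rewrite inE => ->; rewrite xU /=; apply: contra NUw.
by apply: connect_trans; apply: connect1; rewrite /avoid /= rwx wU.
Qed.

End TerminalVertices.

(** * Equitable colourings and moves of single vertices *)

Section Colorings.

Variables (T C : finType) (s : nat).
Implicit Types (e : rel T) (D : {set T}) (K : {set C}) (f g : T -> C).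

Definition color_class D f c : {set T} := [set x in D | f x == c].

Definition neighbors e D x : {set T} := [set y in D | e x y].

Definition class_neighbors e D f x c : {set T} := color_class (neighbors e D x) f c.

Definition proper e D f : Prop := {in D &, forall x y, e x y -> f x != f y}.

Definition equitable e D K f : Prop :=
  [/\ {in D, forall x, f x \in K}, proper e D f
    & {in K, forall c, #|color_class D f c| = s}].

(* The class of a is one vertex short and the class of b has one vertex too
   many; if a = b, this is an equitable colouring. *)
Definition nearly_equitable e D K f a b : Prop :=
  [/\ {in D, forall x, f x \in K}, proper e D f
    & {in K, forall c, #|color_class D f c| + (c == a) = s + (c == b)}].

Lemma card_by_color D K f : {in D, forall x, f x \in K} ->
  #|D| = \sum_(c in K) #|color_class D f c|.
Proof.
move=> fK; rewrite -sum1_card (partition_big f (mem K)) //=.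
by apply: eq_bigr => c _; rewrite -sum1_card; apply: eq_bigl => x; rewrite inE.
Qed.

Lemma free_color D K f : #|D| < #|K| ->
  exists2 c, c \in K & {in D, forall x, f x != c}.
Proof.
move=> DK; have /subsetPn[c cK cN] : ~~ (K \subset f @: D).
  apply: contraL DK => /subset_leq_card KD; rewrite -leqNgt.
  exact: leq_trans KD (leq_imset_card _ _).
by exists c => // x xD; apply: contraNneq cN => <-; exact: imset_f.
Qed.

Definition recolor f x c : T -> C := fun y => if y == x then c else f y.

Definition movable e D f x c : bool := class_neighbors e D f x c == set0.

(** The auxiliary digraph of Kierstead and Kostochka: along an arc, a surplus vertex can be passed
    from one colour class to the next. *)
Definition arc e D f : rel C :=
  fun c d => [exists x in D, (f x == c) && movable e D f x d].

Lemma movableP e D f x c :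
  reflect {in D, forall y, e x y -> f y != c} (movable e D f x c).
Proof.
apply: (iffP eqP) => [N0 y yD exy | mov].
  by apply/negP => fyc; have := in_set0 y; rewrite -N0 !inE yD exy fyc.
apply/setP => y; rewrite !inE; apply/negP => /andP[/andP[yD exy]].
by apply/negP/mov.
Qed.

Lemma card_class_recolor D f x c d : x \in D ->
  #|color_class D (recolor f x d) c| + (c == f x) = #|color_class D f c| + (c == d).
Proof.
move=> xD; rewrite (cardsD1 x) [in RHS](cardsD1 x) !inE xD /recolor eqxx /=.
rewrite (eq_sym d) (eq_sym (f x)).
suff -> : color_class D (recolor f x d) c :\ x = color_class D f c :\ x by lia.
by apply/setP => y; rewrite !inE /recolor; case: eqP.
Qed.

(** The same vertex witnesses the arc, because class [u] loses nothing and class [v] gains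
    nothing. *)
Lemma class_arcs_refine e D f g u v : {in D, forall x, f x = u -> g x = u} ->
  {in D, forall x, g x = v -> f x = v} -> arc e D f u v -> arc e D g u v.
Proof.
move=> fgu gfv /exists_inP[x xD /andP[/eqP fx /movableP mov]].
apply/exists_inP; exists x => //; rewrite fgu // eqxx /=.
apply/movableP => y yD exy; apply/eqP => /(gfv _ yD) fy.
by have := mov y yD exy; rewrite fy eqxx.
Qed.

Lemma recolor_proper e D f x c : symmetric e -> irreflexive e ->
  proper e D f -> movable e D f x c -> proper e D (recolor f x c).
Proof.
move=> e_sym e_irr fP /movableP mov u v uD vD; rewrite /recolor.
have [->|_] := eqVneq u x; have [->|_] := eqVneq v x; rewrite ?e_irr //.
- by move=> exv; rewrite eq_sym mov.
- by rewrite e_sym => exu; rewrite mov.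
- exact: fP.
Qed.

Lemma nearly_equitable_recolor e D K f a b x c : symmetric e -> irreflexive e ->
  nearly_equitable e D K f a b -> x \in D -> f x = b -> c \in K ->
  movable e D f x c -> nearly_equitable e D K (recolor f x c) a c.
Proof.
move=> e_sym e_irr [fK fP fs] xD fx cK mov; split.
- by move=> y yD; rewrite /recolor; case: ifP => // _; exact: fK.
- exact: recolor_proper.
- move=> d dK; have := card_class_recolor f d c xD; have := fs d dK.
  by rewrite fx; lia.
Qed.

(** The surplus travels arc by arc from [b] to [a], where it cancels the deficit. *)
Lemma shift_path e D K f a b p : symmetric e -> irreflexive e ->
  nearly_equitable e D K f a b -> path (arc e D f) b p -> uniq (b :: p) ->
  {subset p <= K} -> last b p = a -> exists g, equitable e D K g.
Proof.
move=> e_sym e_irr.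
elim: p f b => [|c p IH] f b near_f /=.
  move=> _ _ _ ba; exists f; case: near_f => fK fP fs; split=> // c cK.
  by have := fs c cK; rewrite ba; lia.
case/andP=> /exists_inP[x xD /andP[/eqP fx mov]] pathp.
case/andP; rewrite inE negb_or => /andP[bc bp] /andP[cp up] sub lastp.
have cK : c \in K by apply: sub; rewrite mem_head.
apply: (IH (recolor f x c) c) => //.
- by apply: nearly_equitable_recolor near_f _ _ _ _.
(* The move only shrinks class [b] and enlarges class [c]. As the path is simple, no later arc
   starts at [b] or ends at [c]. *)
- apply: path_arcs_sub pathp => u v uP vP.
  have uNb : u != b by apply/eqP => ub; move: uP; rewrite ub inE (negPf bc) (negPf bp).
  have vNc : v != c by apply: contraNneq cp => <-.
  have vNb : v != b by apply: contraNneq bp => <-.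
  apply: class_arcs_refine => y yD; rewrite /recolor; case: eqP => // ->.
    by rewrite fx => bu; rewrite bu eqxx in uNb.
  by move=> cv; rewrite cv eqxx in vNc.
- by rewrite /= cp.
- by move=> d dp; apply: sub; rewrite inE dp orbT.
Qed.

(** * Accessible colours of a nearly equitable colouring *)

Section NearlyEquitable.

Variables (e : rel T) (D : {set T}) (K : {set C}) (f : T -> C) (a b : C).
Hypotheses (e_sym : symmetric e) (e_irr : irreflexive e).
Hypothesis deg_lt : {in D, forall x, #|neighbors e D x| < #|K|}.
Hypotheses (aK : a \in K) (bK : b \in K).
Hypothesis near_f : nearly_equitable e D K f a b.

Local Notation Acc := (accessible (arc e D f) a).
Local Notation N x c := (#|class_neighbors e D f x c|).
Local Notation q := (#|K :\: Acc|).

Let B : {set T} := [set x in D | f x \notin Acc].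

Lemma accessible_colors : Acc \subset K.
Proof.
case: near_f => fK _ _; apply/subsetP => c; rewrite inE => /connectP[[|d p] /=].
  by move=> _ <-.
by case/andP=> /exists_inP[x xD /andP[/eqP <- _]] _ _; exact: fK.
Qed.

Lemma card_colors : #|K| = #|Acc| + q.
Proof. by rewrite -(cardsID Acc K) (setIidPr accessible_colors). Qed.

(** Otherwise [y] could move to [c], and its own colour would be accessible. *)
Lemma inaccessible_neighbors y c : y \in B -> c \in Acc -> 0 < N y c.
Proof.
rewrite inE => /andP[yD fy] accc; rewrite card_gt0; apply: contra fy => mov.
move: accc; rewrite !inE; apply: connect_trans; apply: connect1.
by apply/exists_inP; exists y => //; rewrite eqxx.
Qed.

Lemma degree_split x : #|neighbors e D x| = \sum_(c in Acc) N x c + #|neighbors e B x|.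
Proof.
rewrite -(cardsID B (neighbors e D x)) addnC; congr (_ + _).
  rewrite (@card_by_color _ Acc f) => [|y]; last first.
    by rewrite !inE => /andP[+ /andP[yD _]]; rewrite yD /= negbK.
  apply: eq_bigr => c accc; apply: eq_card => y; rewrite !inE.
  case: eqP => [fy|]; last by rewrite !andbF.
  by move: accc; rewrite fy inE => ->; rewrite andbF.
by apply: eq_card => y; rewrite !inE; case: (y \in D); rewrite ?andbF //= andbC.
Qed.

(** At least one neighbour of [y] is spent on each accessible colour. *)
Lemma degree_in_B y : y \in B -> #|neighbors e B y| < q.
Proof.
move=> yB; have yD : y \in D by move: yB; rewrite inE => /andP[].
have := deg_lt yD; rewrite degree_split card_colors.
have : \sum_(c in Acc) 1 <= \sum_(c in Acc) N y c.
  by apply: leq_sum => c; exact: inaccessible_neighbors.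
by rewrite sum1_card; lia.
Qed.

(** The deficient colour [a] is accessible and the surplus colour [b] is not, so the surplus vertex
    lies in [B]. *)
Lemma card_B : b \notin Acc -> #|B| = q * s + 1.
Proof.
move=> bacc; case: near_f => fK _ fs.
rewrite (@card_by_color _ (K :\: Acc) f); last first.
  by move=> x; rewrite !inE => /andP[xD ->]; exact: fK.
transitivity (\sum_(c in K :\: Acc) (s + (c == b))).
  apply: eq_bigr => c; rewrite inE => /andP[accc cK].
  have := fs c cK; rewrite (negPf (contraNneq _ accc)); last by move=> ->; rewrite inE.
  move=> <-; rewrite addn0; apply: eq_card => x; rewrite !inE.
  by case: eqP => [->|]; rewrite ?andbF //; move: accc; rewrite inE => ->; rewrite andbT.
rewrite big_split /= sum_nat_const; congr (_ + _).
rewrite (bigD1 b) /=; last by rewrite inE bacc.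
by rewrite eqxx big1 // => c /andP[_ /negPf ->].
Qed.

Hypothesis bNacc : b \notin Acc.

(* y has no other neighbour than z in the class of z. *)
Definition solo z y : bool := e z y && (N y (f z) == 1).

Lemma solo_unique z y v : z \in D -> v \in D -> solo z y -> e v y -> f v = f z -> v = z.
Proof.
move=> zD vD /andP[ezy /cards1P[x Nx]] evy fvz.
have zN : z \in [set x] by rewrite -Nx !inE zD e_sym ezy eqxx.
have vN : v \in [set x] by rewrite -Nx !inE vD e_sym evy fvz eqxx.
by rewrite !in_set1 in zN vN; rewrite (eqP zN) (eqP vN).
Qed.

(** * Exchanging an accessible vertex for a vertex of [B] *)

Section Exchange.

Variables (z y : T) (h : T -> C) (c : C).
Hypotheses (zD : z \in D) (fz : f z \in Acc) (yB : y \in B) (zy : solo z y).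
Hypothesis eq_h : equitable e (B :\ y) (K :\: Acc) h.
Hypotheses (cK : c \in K) (cz : c != f z).

Definition replaced : T -> C :=
  fun x => if x == y then f z else if f x \in Acc then f x else h x.

(* y takes the place of z, z gets the colour c, and the rest of B follows h. *)
Definition exchanged : T -> C := recolor replaced z c.

Let yD : y \in D. Proof. by move: yB; rewrite inE => /andP[]. Qed.

Let fy : f y \notin Acc. Proof. by move: yB; rewrite inE => /andP[]. Qed.

Let zNy : z != y. Proof. by apply: contraTneq fz => ->. Qed.

Let hK x : x \in D -> x != y -> f x \notin Acc -> (h x \in K) && (h x \notin Acc).
Proof.
case: eq_h => hK _ _ xD xy fx.
have /hK : x \in B :\ y by rewrite in_setD1 xy in_set xD fx.
by rewrite in_setD andbC.
Qed.

Lemma replaced_accessible x v : x \in D -> v \in Acc -> v != f z ->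
  replaced x = v -> f x = v.
Proof.
move=> xD accv vz; rewrite /replaced; have [_ vE|xy] := eqVneq x y.
  by rewrite vE eqxx in vz.
case: ifPn => // fx vE; have := hK xD xy fx.
by rewrite vE accv andbF.
Qed.

(** Accessible classes other than that of [z] lose no vertex, and only [c] may gain one, namely
    [z]. *)
Lemma exchanged_arc u v : u \in Acc -> v \in Acc -> u != f z -> v != f z -> v != c ->
  arc e D f u v -> arc e D exchanged u v.
Proof.
move=> accu accv uz vz vc; apply: class_arcs_refine => x xD; last first.
  rewrite /exchanged /recolor; case: eqP => [_ cv|_]; first by rewrite cv eqxx in vc.
  exact: replaced_accessible.
move=> fxu; rewrite /exchanged /recolor /replaced.
rewrite (negPf (contraNneq _ uz)); last by move=> <-; rewrite fxu.
by rewrite (negPf (contraNneq _ fy)) ?fxu ?accu //; move=> <-; rewrite fxu.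
Qed.

(** The vertex [y] may enter the class of [z] because its only neighbour there, [z], leaves; [h]
    uses inaccessible colours only, so it cannot clash with the accessible classes. *)
Lemma exchanged_proper : movable e D replaced z c -> proper e D exchanged.
Proof.
case: near_f eq_h => fK fP fs [hK' hP hs] /movableP mov.
(* Pairs away from [z], with [u] different from [y]; the case [u = y] follows by symmetry. *)
have repP u v : u \in D -> v \in D -> u != z -> v != z -> u != y ->
    e u v -> replaced u != replaced v.
  move=> uD vD uz vz uy euv; rewrite /replaced (negPf uy).
  have [vy|vy] := eqVneq v y.
    subst v; case: ifPn => fu; last first.
      by have /andP[_] := hK uD uy fu; apply: contraNneq => ->.
    by apply: contraNneq uz => fuz; apply/eqP/(solo_unique zD uD zy).
  case: ifPn => fu; case: ifPn => fv.
  - exact: fP.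
  - by have /andP[_] := hK vD vy fv; apply: contraNneq => <-.
  - by have /andP[_] := hK uD uy fu; apply: contraNneq => ->.
  - by apply: hP; rewrite // in_setD1 inE ?uy ?vy ?uD ?vD.
move=> u v uD vD; rewrite /exchanged /recolor.
have [->|uz] := eqVneq u z; have [->|vz] := eqVneq v z; rewrite ?e_irr //.
- by move=> ezv; rewrite eq_sym mov.
- by rewrite e_sym => ezu; rewrite mov.
have [uy|uy] := eqVneq u y; last exact: repP.
have [vy|vy] := eqVneq v y; first by rewrite uy vy e_irr.
by move=> euv; rewrite eq_sym repP // e_sym.
Qed.

Lemma exchanged_nearly_equitable : movable e D replaced z c ->
  nearly_equitable e D K exchanged a c.
Proof.
move=> mov; case: near_f eq_h => fK fP fs [hK' hP hs].
split; [|exact: exchanged_proper|].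
  move=> x xD; rewrite /exchanged /recolor /replaced; case: ifP => // _.
  case: eqVneq => [_|xy]; first exact: fK.
  by case: ifPn => [_|/(hK xD xy)/andP[]//]; exact: fK.
have ry : replaced y = f z by rewrite /replaced eqxx.
have rz : replaced z = f z by rewrite /replaced (negPf zNy) fz.
(* Before [z] moves, the surplus sits in its class, which [y] has joined, while [h] fills the
   inaccessible classes exactly. Moving [z] carries the surplus to [c]. *)
have sizes : {in K, forall d, #|color_class D replaced d| + (d == a) = s + (d == f z)}.
  move=> d dK; have [accd|accd] := boolP (d \in Acc).
    have db : (d == b) = false by apply: contraNF bNacc => /eqP <-.
    have := fs d dK; rewrite db.
    rewrite [#|color_class D replaced d|](cardsD1 y) !inE yD ry /= (eq_sym (f z)).
    suff -> : color_class D replaced d :\ y = color_class D f d.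
      by rewrite addn0 -addnA => ->; rewrite addnC.
    apply/setP => x; rewrite !inE /replaced; have [->|xy] /= := eqVneq x y.
      by rewrite (negPf (contraNneq _ fy)) ?andbF // => ->.
    case xD : (x \in D) => //=; case: ifPn => // fx.
    have /andP[_ hx] := hK xD xy fx.
    by rewrite (negPf (contraNneq _ hx)) ?(negPf (contraNneq _ fx)) // => ->.
  have dz : (d == f z) = false by apply: contraNF accd => /eqP ->.
  have da : (d == a) = false by apply: contraNF accd => /eqP ->; rewrite inE.
  rewrite dz da !addn0 -(hs d) ?inE ?(accd, dK) //; last by move: accd; rewrite inE => ->.
  apply: eq_card => x; rewrite !inE /replaced; have [->|xy] /= := eqVneq x y.
    by rewrite eq_sym dz andbF.
  case xD : (x \in D) => //=; case: ifPn => [fx|fx].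
    by move: (fx); rewrite inE => ->; apply: contraNF accd => /eqP <-.
  by move: (fx); rewrite inE => ->.
move=> d dK; have := sizes d dK.
have := card_class_recolor replaced d c zD; rewrite rz -/exchanged.
rewrite (eq_sym d c) (eq_sym d (f z)); clear; lia.
Qed.

End Exchange.

(** * Counting edges between [B] and the classes of a minimal cut *)

Section Counting.

(** These stand for the output of [exists_minimal_cut]. [W_out] expresses that arcs leave [W] only
    towards [U]; [W_solo] is what remains when no vertex of a [W] class with a solo neighbour in [B]
    can move to another accessible class. *)
Variables (W : {set C}) (U : C).
Hypotheses (W_neq0 : W != set0) (WAcc : W \subset Acc) (aNW : a \notin W).
Hypotheses (UAcc : U \in Acc) (UNW : U \notin W).
Hypothesis W_out : {in D, forall z, f z \in W -> {in Acc, forall c,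
  c \notin W -> c != U -> 0 < N z c}}.
Hypothesis W_solo : {in D & B, forall z y, f z \in W -> solo z y ->
  {in Acc, forall c, c != f z -> 0 < N z c}}.

Lemma W_degree_in_B z : z \in D -> f z \in W -> #|neighbors e B z| <= q + #|W|.
Proof.
move=> zD fz; have := deg_lt zD; rewrite degree_split card_colors.
have : \sum_(c in Acc :\: (U |: W)) 1 <= \sum_(c in Acc) N z c.
  rewrite [leqRHS](big_setID (U |: W)) /= -[leqLHS]add0n leq_add //.
  apply: leq_sum => c; rewrite in_setD in_setU1 negb_or => /andP[/andP[cU cW] accc].
  exact: W_out.
rewrite sum1_card; have := cardsID (U |: W) Acc.
have /setIidPr -> : U |: W \subset Acc by rewrite subUset sub1set UAcc.
rewrite cardsU1 UNW.
move: #|_ :\: _| #|_ :\: _| (\sum_(_ in _) _) #|Acc| #|neighbors _ _ _| #|W|; clear; lia.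
Qed.

Lemma solo_degree_in_B z y : z \in D -> f z \in W -> y \in B -> solo z y ->
  #|neighbors e B z| <= q.
Proof.
move=> zD fz yB zy; have := deg_lt zD; rewrite degree_split card_colors.
have : \sum_(c in Acc :\ f z) 1 <= \sum_(c in Acc) N z c.
  rewrite [leqRHS](big_setID [set f z]) /= -[leqLHS]add0n leq_add //.
  apply: leq_sum => c; rewrite in_setD1 => /andP[cz accc].
  exact: (W_solo zD yB fz zy).
rewrite sum1_card; have := cardsD1 (f z) Acc; rewrite (subsetP WAcc _ fz).
move: #|_ :\: _| #|_ :\ _| (\sum_(_ in _) _) #|Acc| #|neighbors _ _ _|; clear; lia.
Qed.

Lemma card_W_class w : w \in W -> #|color_class D f w| = s.
Proof.
move=> wW; have wacc := subsetP WAcc _ wW; case: near_f => _ _ fs.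
have := fs w (subsetP accessible_colors _ wacc).
rewrite (_ : w == a = false); last by apply: contraNF aNW => /eqP <-.
rewrite (_ : w == b = false); last by apply: contraNF bNacc => /eqP <-.
by rewrite !addn0.
Qed.

(** Weighted double counting between [B] and one class [w]. If [#|W| <= q], each of the [s] vertices
    of the class sends weight at most [2 * q]: a solo one has weight 2 and at most [q] neighbours in
    [B], any other has weight 1 and at most [q + #|W|]. But [B] must receive [2 * (q * s + 1)]. *)
Lemma card_W_gt : q < #|W|.
Proof.
have /set0Pn[w wW] := W_neq0; rewrite ltnNge; apply/negP => Wq.
have wacc := subsetP WAcc _ wW.
(* Every y in B receives weight at least 2 from its neighbours in the class w. *)
pose wt z := if [exists y in B, solo z y] then 2 else 1.
have wt_ge1 z : 0 < wt z by rewrite /wt; case: ifP.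
have low : \sum_(y in B) 2 <= \sum_(y in B) \sum_(z in color_class D f w | e z y) wt z.
  apply: leq_sum => y yB.
  have clE z : (z \in color_class D f w) && e z y = (z \in class_neighbors e D f y w).
    by rewrite !inE e_sym andbAC.
  rewrite (eq_bigl _ _ clE).
  have := inaccessible_neighbors yB wacc; rewrite leq_eqVlt => /predU1P[N1|N2].
    have /cards1P[z Nz] : N y w == 1 by rewrite -N1.
    rewrite Nz big_set1 /wt; case: existsP => //= -[]; exists y; rewrite yB /=.
    have : z \in [set z] by rewrite in_set1.
    by rewrite -Nz !inE /solo e_sym => /andP[/andP[_ ->] /eqP ->]; rewrite -N1.
  apply: leq_trans N2 _; rewrite -sum1_card; exact: leq_sum.
have up : \sum_(y in B) \sum_(z in color_class D f w | e z y) wt z <=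
          \sum_(z in color_class D f w) 2 * q.
  rewrite (exchange_big_dep (mem (color_class D f w))) /=; last by move=> y z _ /andP[].
  apply: leq_sum => z zw.
  rewrite (eq_bigl (mem (neighbors e B z))) => [|y]; last first.
    by rewrite /= [in RHS]in_set zw.
  rewrite sum_nat_const.
  have [zD /eqP fz] : z \in D /\ f z == w by apply/andP; rewrite inE in zw.
  have fzW : f z \in W by rewrite fz.
  rewrite /wt; case: ifP => [/exists_inP[y yB zy]|_].
    by rewrite mulnC leq_mul2l (solo_degree_in_B zD fzW yB zy).
  have := W_degree_in_B zD fzW; move: Wq.
  by move: #|W| #|neighbors _ _ _| q; clear; lia.
have := leq_trans low up; rewrite !sum_nat_const card_B // card_W_class //.
by move: q; clear; lia.
Qed.

(** The vertex [y] has a neighbour in each accessible class and a second one in each class of [W]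
    where it is not solo; the degree bound limits the number of the latter. *)
Lemma solo_count y : y \in B ->
  #|W| + (#|neighbors e B y|).+1 <= #|[set w in W | N y w == 1]| + q.
Proof.
move=> yB; have yD : y \in D by move: yB; rewrite inE => /andP[].
have := deg_lt yD; rewrite degree_split card_colors.
have : \sum_(c in Acc) (1 + (c \in W :\: [set w in W | N y w == 1])) <= \sum_(c in Acc) N y c.
  apply: leq_sum => c accc; have := inaccessible_neighbors yB accc.
  rewrite in_setD in_set; case: (c \in W) => //=.
  by rewrite andbT; case: eqP => /=; move: (N y c); clear; lia.
rewrite big_split /= sum1_card.
have -> : \sum_(c in Acc) (c \in W :\: [set w in W | N y w == 1]) =
        #|W :\: [set w in W | N y w == 1]|.
  rewrite -sum1_card [RHS](big_setID Acc) /= [X in _ = _ + X]big1 => [|c]; last first.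
    by rewrite !in_setD => /andP[cN /andP[_ /(subsetP WAcc) cY]]; rewrite cY in cN.
  rewrite addn0 (big_mkcond (fun c => c \in _ :&: _)) [LHS]big_mkcond /=.
  by apply: eq_bigr => c _; rewrite in_setI andbC; case: ifP => //; case: (c \in _).
have := cardsID [set w in W | N y w == 1] W.
have /setIidPr -> : [set w in W | N y w == 1] \subset W.
  by apply/subsetP => w; rewrite inE => /andP[].
move: #|_ :\: _| #|_ :\: _| #|[set _ in _ | _]| (\sum_(_ in _) _) #|Acc|.
by move: #|neighbors _ _ _| #|W|; clear; lia.
Qed.

(** The closed neighbourhoods of the members of an independent set of maximum size cover [B]. *)
Lemma exists_independent : exists I : {set T},
  [/\ I \subset B, {in I &, forall x y, ~~ e x y}
    & #|B| <= \sum_(y in I) (#|neighbors e B y|).+1].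
Proof.
pose indep (I : {set T}) := (I \subset B) && [forall x in I, forall y in I, ~~ e x y].
have indep0 : indep set0.
  by rewrite /indep sub0set; apply/forall_inP => x; rewrite inE.
case: (arg_maxnP (fun I : {set T} => #|I|) indep0) => I /andP[IB /forall_inP indI] maxI.
exists I; split=> //; first by move=> x y xI yI; apply: (forall_inP (indI x xI)).
rewrite -sum1_card.
have cover : {in B, forall x, exists2 y, y \in I & (x == y) || e y x}.
  move=> x xB; have [/exists_inP[y yI exy]|none] := boolP [exists y in I, (x == y) || e y x].
    by exists y.
  have xNe y : y \in I -> (x != y) && ~~ e y x.
    by move=> yI; have := exists_inPn none y yI; rewrite negb_or.
  have xNI : x \notin I by apply/negP => /xNe; rewrite eqxx.
  suff /maxI : indep (x |: I) by rewrite /= cardsU1 xNI add1n ltnn.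
  rewrite /indep subUset sub1set xB IB; apply/forall_inP => u uI.
  apply/forall_inP => v vI; move: uI vI; rewrite !in_setU1.
  case/predU1P=> [->|uI] /predU1P[->|vI]; first by rewrite e_irr.
  - by rewrite e_sym; have /andP[] := xNe v vI.
  - by have /andP[] := xNe u uI.
  - exact: (forall_inP (indI u uI)).
have : \sum_(x in B) 1 <= \sum_(x in B) \sum_(y in I | (x == y) || e y x) 1.
  apply: leq_sum => x /cover[y yI xy]; rewrite (bigD1 y) /=; last by rewrite yI.
  exact: leq_addr.
move/leq_trans; apply.
rewrite (exchange_big_dep (mem I)) /=; last by move=> x y _ /andP[].
apply: leq_sum => y yI; rewrite sum1_card.
apply: (@leq_trans #|y |: neighbors e B y|).
  apply/subset_leq_card/subsetP => x /andP[xB /andP[_]].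
  by rewrite in_setU1 in_set xB.
by rewrite cardsU1; case: (_ \notin _).
Qed.

(* By solo_count and the independence of I, the vertices of I have in total more
   than #|W| * s solo neighbours in the classes of W, so two of them share one. *)
Lemma exists_common_solo : exists z y1 y2,
  [/\ z \in D, f z \in W, y1 \in B /\ y2 \in B, y1 != y2 /\ ~~ e y1 y2
    & solo z y1 /\ solo z y2].
Proof.
have [I [IB indI cardI]] := exists_independent.
pose A : {set T} := [set z in D | f z \in W].
have cardA : #|A| = #|W| * s.
  rewrite (@card_by_color A W f) => [|z]; last by rewrite inE => /andP[].
  rewrite -sum_nat_const; apply: eq_bigr => w wW; rewrite -(card_W_class wW).
  apply: eq_card => z; rewrite !inE; case: eqP => [->|]; rewrite ?andbF //.
  by rewrite wW !andbT.
have [/exists_inP[z]|none] :=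
  boolP [exists z in A, 1 < #|[set y in I | solo z y]|].
  rewrite inE => /andP[zD fz] /card_gt1P[y1 [y2 []]].
  rewrite !inE => /andP[y1I zy1] /andP[y2I zy2] y12; exists z, y1, y2.
  by split=> //; split=> //; [exact: (subsetP IB)..|exact: indI].
(* Each [z] in [A] is now solo for at most one member of [I]. *)
have up : \sum_(y in I) #|[set z in A | solo z y]| <= #|W| * s.
  rewrite -cardA -sum1_card.
  under eq_bigr do rewrite -sum1_card.
  rewrite (exchange_big_dep (mem A)) /=; last by move=> y z _; rewrite inE => /andP[].
  apply: leq_sum => z zA; rewrite sum1_card leqNgt.
  apply: contra (exists_inPn none z zA) => /leq_trans; apply.
  apply/subset_leq_card/subsetP => y /andP[yI].
  by rewrite in_set => /andP[_ zy]; rewrite in_set yI.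
have low : \sum_(y in I) #|[set w in W | N y w == 1]| <=
           \sum_(y in I) #|[set z in A | solo z y]|.
  apply: leq_sum => y yI; rewrite (@card_by_color _ W f) => [|z]; last first.
    by rewrite !inE => /andP[/andP[_ ->]].
  rewrite -sum1_card (eq_bigl (fun w => (w \in W) && (N y w == 1))); last first.
    by move=> w; rewrite in_set.
  rewrite big_mkcondr /=; apply: leq_sum => w wW; case: eqP => // N1.
  rewrite -N1; apply/subset_leq_card/subsetP => z; rewrite !inE.
  case/andP=> /andP[zD eyz] /eqP fz.
  by rewrite zD fz wW /solo e_sym eyz eqxx fz N1.
have qI : #|B| <= #|I| * q.
  apply: leq_trans cardI _; rewrite -sum_nat_const; apply: leq_sum => y yI.
  exact/degree_in_B/(subsetP IB).
have : \sum_(y in I) (#|W| + (#|neighbors e B y|).+1) <=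
       \sum_(y in I) (#|[set w in W | N y w == 1]| + q).
  by apply: leq_sum => y yI; apply/solo_count/(subsetP IB).
rewrite !big_split /= !sum_nat_const; move: cardI qI card_W_gt (leq_trans low up).
rewrite card_B //.
set S := \sum_(y in I) (#|neighbors e B y|).+1.
move: S (\sum_(y in I) _) #|I| #|W| q; clear => S R i w k Sge ik kw Rle.
(* From [k * s + 1 <= i * k]. Then [k < w] gives [w * (i - s) >= (k + 1) * (i - s)], and adding
   [S >= k * s + 1] exceeds [i * k], against the summed bound. *)
have : s < i by nia.
by nia.
Qed.

End Counting.

(** * Repairing the colouring or enlarging the set of accessible colours *)

Hypothesis smaller_equitable : forall (D' : {set T}) (K' : {set C}), #|D'| < #|D| ->
  #|D'| = #|K'| * s -> {in D', forall x, #|neighbors e D' x| < #|K'|} ->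
  exists h, equitable e D' K' h.

(** If [a] were alone, its [s - 1] vertices, with at most [q] neighbours each, would have to reach
    all [q * s + 1] vertices of [B]. *)
Lemma accessible_gt1 : 1 < #|Acc|.
Proof.
have acca : a \in Acc by rewrite inE.
rewrite ltnNge; apply/negP => acc_le1.
have accE c : c \in Acc -> c = a by move/card_le1P: acc_le1 => /(_ a acca) ->; move/eqP.
have low : \sum_(y in B) 1 <= \sum_(y in B) \sum_(z in color_class D f a | e z y) 1.
  apply: leq_sum => y yB; apply: leq_trans (inaccessible_neighbors yB acca) _.
  rewrite -sum1_card; apply: eq_leq; apply: eq_bigl => z.
  by rewrite !inE e_sym andbAC.
have up : \sum_(y in B) \sum_(z in color_class D f a | e z y) 1 <=
          \sum_(z in color_class D f a) q.
  rewrite (exchange_big_dep (mem (color_class D f a))) /=; last by move=> y z _ /andP[].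
  apply: leq_sum => z za.
  rewrite (eq_bigl (mem (neighbors e B z))) => [|y]; last by rewrite /= [in RHS]in_set za.
  have zD : z \in D by move: za; rewrite inE => /andP[].
  rewrite sum1_card; have := deg_lt zD; rewrite degree_split card_colors.
  move: acc_le1; move: #|_ :\: _| #|neighbors _ _ _| (\sum_(_ in _) _) #|Acc|; clear; lia.
have := leq_trans low up; rewrite !sum_nat_const muln1 card_B //.
case: near_f => _ _ /(_ a aK).
rewrite eqxx (_ : a == b = false); last by apply: contraNF bNacc => /eqP <-.
by move: #|color_class _ _ _| q; clear; nia.
Qed.

(** Without [y] the set [B] has exactly [q * s] vertices, and its inner degrees are below [q], so
    induction applies. *)
Lemma rest_equitable y : y \in B -> exists h, equitable e (B :\ y) (K :\: Acc) h.
Proof.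
move=> yB; have BD : B \subset D by apply/subsetP => x; rewrite inE => /andP[].
have := cardsD1 y B; rewrite yB card_B // addn1 add1n => -[cardBy].
apply: smaller_equitable.
- apply: leq_trans (subset_leq_card BD).
  by rewrite [leqRHS](cardsD1 y) yB.
- by rewrite -cardBy.
move=> x; rewrite in_setD1 => /andP[_ xB]; apply: leq_ltn_trans (degree_in_B xB).
apply/subset_leq_card/subsetP => v; rewrite in_set in_setD1.
by case/andP=> /andP[_ vB] xv; rewrite in_set vB.
Qed.

(** If some solo [z] in a class of [W] can move to another accessible colour [c], the exchange puts
    the surplus at [c], from where it is shifted to [a]. Otherwise two nonadjacent [y1], [y2] share
    a solo neighbour [z]: [y1] replaces [z], [z] goes to an inaccessible class, and the new class of
    [y2] becomes accessible. *)
Lemma improve_accessible : (exists g, equitable e D K g) \/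
  exists g c, [/\ c \in K, nearly_equitable e D K g a c
                & #|Acc| < #|accessible (arc e D g) a|].
Proof.
have [W [U [W0 WAcc aNW [UAcc UNW] cutW]]] := exists_minimal_cut accessible_gt1.
have W_out : {in D, forall z, f z \in W -> {in Acc, forall c,
    c \notin W -> c != U -> 0 < N z c}}.
  move=> z zD fz c accc cW cU; rewrite card_gt0; have [_ /(_ cW cU)] := cutW _ fz c accc.
  by apply: contra => mov; apply/exists_inP; exists z; rewrite // eqxx.
have [|noflex] := boolP [exists z in D, [exists y in B, [exists c in Acc,
    [&& f z \in W, solo z y, c != f z & movable e D f z c]]]].
  case/exists_inP=> z zD /exists_inP[y yB /exists_inP[c accc /and4P[fz zy cz mov]]].
  left; have fzAcc := subsetP WAcc _ fz; have cK := subsetP accessible_colors _ accc.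
  have [h eq_h] := rest_equitable yB.
  have movr : movable e D (replaced z y h) z c.
    apply/movableP => v vD ezv; apply: contraNneq (movableP _ _ _ _ _ mov v vD ezv).
    by move/(replaced_accessible eq_h vD accc cz) => ->.
  have near_g := exchanged_nearly_equitable zD fzAcc yB zy eq_h cK movr.
  (* The class of [z] is not a cut, so [c] has a simple path to [a] avoiding it; the exchange
     preserves its arcs, none of which returns to [c]. *)
  have [/(_ cz) /connect_avoidP[p [pathp up lastp subp]] _] := cutW _ fz c accc.
  apply: (shift_path e_sym e_irr near_g _ up _ lastp); last first.
    by move=> u pu; apply/(subsetP accessible_colors)/subp; rewrite inE pu orbT.
  apply: path_arcs_sub pathp => u v uP vP /and3P[auv uz vz].
  apply: (exchanged_arc yB eq_h) => //; first exact: subp.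
    by apply: subp; rewrite inE vP orbT.
  by apply: contraTneq up => <-; rewrite /= vP.
have W_solo : {in D & B, forall z y, f z \in W -> solo z y ->
    {in Acc, forall c, c != f z -> 0 < N z c}}.
  move=> z y zD yB fz zy c accc cz; rewrite card_gt0; apply: contra noflex => mov.
  apply/exists_inP; exists z => //; apply/exists_inP; exists y => //.
  by apply/exists_inP; exists c => //; rewrite fz zy cz.
have [z [y1 [y2 [zD fz [y1B y2B] [y12 Ny12] [zy1 zy2]]]]] :=
  exists_common_solo W0 WAcc aNW UAcc UNW W_out W_solo.
right; have fzAcc := subsetP WAcc _ fz.
have [h eq_h] := rest_equitable y1B.
have [c cKA hc] : exists2 c, c \in K :\: Acc &
    {in B :\ y1, forall v, e z v -> h v != c}.
  (* At most [q] neighbours of [z] lie in [B], and [y1] is one of them, so an inaccessible colour is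
     free for [z]. *)
  have nbr_lt : #|neighbors e (B :\ y1) z| < q.
    apply: leq_trans (solo_degree_in_B WAcc W_solo zD fz y1B zy1).
    rewrite [leqRHS](cardsD1 y1) in_set y1B; have /andP[-> _] := zy1.
    rewrite ltnS; apply/subset_leq_card/subsetP => v.
    by rewrite in_set !in_setD1 [in X in _ -> X]in_set => /andP[/andP[-> ->]].
  have [c cKA cN] := free_color h nbr_lt; exists c => // v vB ezv.
  by apply: cN; rewrite in_set vB.
move: (cKA); rewrite in_setD => /andP[cNAcc cK].
have cz : c != f z by apply: contraNneq cNAcc => ->.
have in_rest v : v \in D -> v != y1 -> f v \notin Acc -> v \in B :\ y1.
  by move=> vD vy1 fv; rewrite in_setD1 vy1 in_set vD.
have h_acc v : v \in B :\ y1 -> h v \notin Acc.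
  by case: eq_h => hK _ _ /hK; rewrite in_setD => /andP[].
have movr : movable e D (replaced z y1 h) z c.
  apply/movableP => v vD ezv; rewrite /replaced.
  have [_|vy1] := eqVneq v y1; first by rewrite eq_sym.
  case: ifPn => fv; first by apply: contraNneq cNAcc => <-.
  by apply: hc => //; apply: in_rest.
exists (exchanged z y1 h c), c; split=> //.
  exact: exchanged_nearly_equitable zD fzAcc y1B zy1 eq_h cK movr.
set g := exchanged z y1 h c.
have arcs u v : u \in Acc -> v \in Acc -> u != f z -> v != f z ->
    arc e D f u v -> arc e D g u v.
  move=> accu accv uz vz; apply: (exchanged_arc y1B eq_h) => //.
  by apply: contraNneq cNAcc => <-.
have conn x : x \in Acc -> x != f z -> connect (arc e D g) x a.
  move=> accx xz; have [/(_ xz) /connect_avoidP[p [pathp _ lastp subp]] _] := cutW _ fz x accx.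
  apply/connectP; exists p => //; apply: path_arcs_sub pathp => u v uP vP /and3P[auv uz vz].
  by apply: arcs => //; apply: subp => //; rewrite inE vP orbT.
(* Only the first arc out of the class of [z] is at stake; by [W_solo] its witness is not [z], so it
   stays in the class. *)
have conn_z : connect (arc e D g) (f z) a.
  have /connectP[p /shortenP[[|x q']]] : connect (arc e D f) (f z) a by rewrite inE in fzAcc.
    by move=> _ _ _ /= za; rewrite za fz in aNW.
  move=> pathq uq _ /esym lastq.
  have accx : x \in Acc by apply: (path_accessible pathq lastq); rewrite !inE eqxx orbT.
  have xz : x != f z by move: uq; rewrite /= inE negb_or eq_sym => /andP[/andP[]].
  apply: connect_trans (conn x accx xz); apply: connect1.
  move: pathq => /= /andP[/exists_inP[w wD /andP[/eqP fw mov]] _].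
  have wz : w != z.
    have := W_solo _ _ zD y1B fz zy1 x accx xz; rewrite card_gt0.
    by apply: contraNneq => <-.
  have wy1 : w != y1.
    apply: contraTneq fzAcc => wy; rewrite -fw wy.
    by move: y1B; rewrite in_set => /andP[].
  apply/exists_inP; exists w => //; apply/andP; split.
    by rewrite /g /exchanged /recolor /replaced (negPf wz) (negPf wy1) fw fzAcc.
  apply/movableP => v vD ewv; rewrite /g /exchanged /recolor.
  have [_|_] := eqVneq v z; first by apply: contraNneq cNAcc => ->.
  apply: contraNneq (movableP _ _ _ _ _ mov v vD ewv).
  by move/(replaced_accessible eq_h vD accx xz) => ->.
have y2R : y2 \in B :\ y1 by rewrite in_setD1 eq_sym y12.
have y2D : y2 \in D by move: y2B; rewrite in_set => /andP[].
have fy2 : f y2 \notin Acc by move: y2B; rewrite in_set => /andP[].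
have gy2 : g y2 = h y2.
  have y21 : (y2 == y1) = false by rewrite eq_sym (negPf y12).
  have y2z : (y2 == z) = false by apply: contraNF fy2 => /eqP ->.
  by rewrite /g /exchanged /recolor /replaced y2z y21 (negPf fy2).
(* The only neighbour of [y2] in the class of [z] has left, and the newcomer [y1] is not adjacent to
   [y2], so [y2] can move there. *)
have conn_y2 : connect (arc e D g) (h y2) a.
  apply: connect_trans conn_z; apply: connect1; apply/exists_inP; exists y2 => //.
  rewrite gy2 eqxx; apply/movableP => v vD ey2v; rewrite /g /exchanged /recolor.
  have [//|vz] := eqVneq v z; rewrite /replaced.
  have [vy1|vy1] := eqVneq v y1; first by rewrite -vy1 e_sym ey2v in Ny12.
  case: ifPn => fv; last by apply: contraTneq fzAcc => <-; exact/h_acc/in_rest.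
  by apply: contraNneq vz => fvz; apply/eqP/(solo_unique zD vD zy2) => //; rewrite e_sym.
have hy2 := h_acc _ y2R.
apply: (@leq_trans #|h y2 |: Acc|); first by rewrite cardsU1 hy2.
apply/subset_leq_card/subsetP => x; rewrite in_setU1 => /predU1P[->|accx].
  by rewrite inE.
by rewrite inE; have [->|xz] := eqVneq x (f z) => //; exact: conn.
Qed.

End NearlyEquitable.

(** * The Hajnal-Szemeredi theorem *)

Lemma nearly_equitable_to_equitable e D K f a b : symmetric e -> irreflexive e ->
  {in D, forall x, #|neighbors e D x| < #|K|} -> a \in K -> b \in K ->
  (forall (D' : {set T}) (K' : {set C}), #|D'| < #|D| -> #|D'| = #|K'| * s ->
    {in D', forall x, #|neighbors e D' x| < #|K'|} -> exists h, equitable e D' K' h) ->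
  nearly_equitable e D K f a b -> exists g, equitable e D K g.
Proof.
move=> e_sym e_irr deg_lt aK bK IH near_f.
(* Induction on the number of inaccessible colours; once [b] is accessible, a path shift
   finishes. *)
have [n] := ubnP (#|K| - #|accessible (arc e D f) a|).
elim: n => // n IHn in f b bK near_f * => /ltnSE acc_n.
have [bacc|bacc] := boolP (b \in accessible (arc e D f) a).
  have /connectP[p /shortenP[p' pathp up _] /esym lastp] : connect (arc e D f) b a.
    by rewrite inE in bacc.
  apply: (shift_path e_sym e_irr near_f pathp up _ lastp) => u up'.
  apply: (subsetP (accessible_colors aK near_f)).
  by apply: (path_accessible pathp lastp); rewrite inE up' orbT.
have [//|[g [c [cK near_g acc_lt]]]] := improve_accessible e_sym e_irr deg_lt aK bK near_f bacc IH.
apply: (IHn g c) => //; apply: leq_trans acc_n.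
have := subset_leq_card (accessible_colors aK near_g); move: acc_lt.
by move: #|accessible _ _| #|accessible _ _| #|K|; clear; lia.
Qed.

Lemma exists_balanced (c0 : C) D K : #|D| = #|K| * s ->
  exists f, {in D, forall x, f x \in K} /\ {in K, forall c, #|color_class D f c| = s}.
Proof.
have [n] := ubnP #|K|; elim: n => // n IHn in D K * => /ltnSE Kn cardD.
have [K0|/set0Pn[c cK]] := eqVneq K set0.
  exists (fun=> c0); split=> [x|c]; last by rewrite K0 inE.
  by move: cardD; rewrite K0 cards0 => /eqP; rewrite cards_eq0 => /eqP ->; rewrite inE.
have cardK : #|K| = #|K :\ c|.+1 by rewrite (cardsD1 c) cK.
pose A : {set T} := [set x in take s (enum D)].
have AD : A \subset D.
  by apply/subsetP => x; rewrite inE => /mem_take; rewrite mem_enum.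
have cardA : #|A| = s.
  rewrite cardsE (card_uniqP _) ?take_uniq ?enum_uniq // size_takel //.
  by rewrite -cardE cardD cardK mulSn leq_addr.
have [||f [fK fs]] := IHn (D :\: A) (K :\ c).
- by rewrite -cardK.
- have := cardsID A D; rewrite (setIidPr AD) cardA cardD cardK mulSn.
  by move/addnI.
exists (fun x => if x \in A then c else f x); split=> [x xD|d dK].
  case: ifPn => // xA; have /fK : x \in D :\: A by rewrite inE xA.
  by rewrite inE => /andP[].
have [->|dc] := eqVneq d c.
  rewrite -cardA; apply: eq_card => x; rewrite [LHS]inE.
  case: ifPn => xA; first by rewrite (subsetP AD) // eqxx.
  apply/negP => /andP[xD /eqP fx]; have /fK : x \in D :\: A by rewrite inE xA.
  by rewrite fx !inE eqxx.
rewrite -(fs d) ?inE ?dc //; apply: eq_card => x; rewrite [LHS]inE [RHS]inE in_setD.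
by case: (x \in A); rewrite //= [c == d]eq_sym (negPf dc) andbF.
Qed.

Theorem hajnal_szemeredi (c0 : C) e D K : symmetric e -> irreflexive e ->
  #|D| = #|K| * s -> {in D, forall x, #|neighbors e D x| < #|K|} ->
  exists f, equitable e D K f.
Proof.
have [n] := ubnP #|D|; elim: n => // n IHn in e D K * => /ltnSE Dn e_sym e_irr cardD deg_lt.
(* Inside the induction on [#|D|], the graph is built up vertex by vertex: only edges within [l] are
   present. *)
pose el (l : seq T) : rel T := fun x y => [&& e x y, x \in l & y \in l].
suff [f [fK fP fs]] : exists f, equitable (el (enum T)) D K f.
  by exists f; split=> // x y xD yD exy; apply: fP => //; rewrite /el exy !mem_enum.
elim: (enum T) => [|u l [f [fK fP fs]]].
  have [f [fK fs]] := exists_balanced c0 cardD; exists f; split=> // x y _ _.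
  by rewrite /el andbF.
have el_sub v x y : v = u -> x != v -> y != v -> el (u :: l) x y -> el l x y.
  by move=> -> xu yu; rewrite /el !inE (negPf xu) (negPf yu).
have [uD|uND] := boolP (u \in D); last first.
  exists f; split=> // x y xD yD exy; apply: fP => //.
  by apply: (el_sub u) exy => //; apply: contraNneq uND => <-.
have el_symm : symmetric (el (u :: l)) by move=> x y; rewrite /el e_sym (andbC (x \in _)).
have el_irr : irreflexive (el (u :: l)) by move=> x; rewrite /el e_irr.
have el_deg D' x : #|neighbors (el (u :: l)) D' x| <= #|neighbors e D' x|.
  by apply/subset_leq_card/subsetP => y; rewrite !inE => /andP[-> /andP[->]].
have deg_u := leq_ltn_trans (el_deg D u) (deg_lt u uD).
(* Adding the edges at [u] can only create conflicts at [u]; moving [u] to a free colour leaves its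
   old class one short and [c] one over. *)
have [c cK free] := free_color f deg_u.
have near : nearly_equitable (el (u :: l)) D K (recolor f u c) (f u) c.
  split; last first.
  - by move=> d dK; rewrite (card_class_recolor _ _ _ uD) fs.
  - move=> x y xD yD; rewrite /recolor.
    have [->|xu] := eqVneq x u; have [->|yu] := eqVneq y u; rewrite ?el_irr //.
    + by move=> euy; rewrite eq_sym free // inE yD.
    + by rewrite el_symm => eux; rewrite free // inE xD.
    + by move/(el_sub u x y erefl xu yu); exact: fP.
  - by move=> x xD; rewrite /recolor; case: ifP => // _; exact: fK.
apply: nearly_equitable_to_equitable near => //; first last.
- by move=> D' K' lt_D' cardD' deg'; apply: IHn => //; exact: leq_trans lt_D' Dn.
- exact: fK.
- by move=> x xD; apply: leq_ltn_trans (el_deg D x) (deg_lt x xD).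
Qed.

End Colorings.

(** * From triangle partitions to partitions into 4-triangles *)

Section FourTriangles.

Variables (V : finType) (M : multigraph V).
Hypothesis stdM : standard M.
Implicit Types (A B D : {set V}) (x y z : V).

Definition clique A : Prop := {in A &, forall x y, x != y -> adjacent M x y}.

Definition four_triangle A : bool :=
  [exists x, exists y, exists z,
    [&& A == [set x; y; z],
        [&& adjacent M x y, adjacent M y z & adjacent M x z]
      & 4 <= M x y + M y z + M x z]].

Lemma four_triangleP A : reflect (contains_4triangle_on M A) (four_triangle A).
Proof.
apply: (iffP existsP) => [[x /existsP[y /existsP[z]]]|[x [y [z [-> adj ge4]]]]].
  by case/and3P=> /eqP -> adj ge4; exists x, y, z.
by exists x; apply/existsP; exists y; apply/existsP; exists z; rewrite eqxx adj.
Qed.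

Lemma adjacent_sym x y : adjacent M x y = adjacent M y x.
Proof. by rewrite /adjacent mu_sym. Qed.

Lemma adjacent_neq x y : adjacent M x y -> x != y.
Proof. by rewrite /adjacent; apply: contraTneq => ->; rewrite mu_loopless. Qed.

Lemma four_triangle_clique A : four_triangle A -> #|A| = 3 /\ clique A.
Proof.
case/four_triangleP=> x [y [z [-> /and3P[xy yz xz] _]]]; split.
  rewrite -setUA cardsU1 cards2 !inE negb_or.
  by rewrite (adjacent_neq xy) (adjacent_neq yz) (adjacent_neq xz).
move=> u v; rewrite !inE -!orbA => /or3P[]/eqP -> /or3P[]/eqP ->;
  by rewrite ?eqxx // adjacent_sym.
Qed.

(** Multiplicities are at most 2, so weight 3 reaches both ends; the edge inside [A] brings the
    total to 4. *)
Lemma apex_four_triangle A x : #|A| = 2 -> clique A -> 3 <= \sum_(y in A) M x y ->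
  four_triangle (x |: A).
Proof.
move=> /eqP/cards2P[y [z [yz ->]]] clA.
have yzadj : adjacent M y z by apply: clA => //; rewrite !inE eqxx ?orbT.
rewrite big_setU1 ?inE //= big_set1 => ge3; have := stdM x y; have := stdM x z => xz xy.
apply/four_triangleP; exists x, y, z; rewrite setUA; split=> //.
  by move: yzadj; rewrite /adjacent; lia.
by move: yzadj; rewrite /adjacent; lia.
Qed.

(** The double sum counts every edge twice. *)
Lemma heavy_clique A : #|A| = 3 -> clique A ->
  8 <= \sum_(x in A) \sum_(y in A) M x y -> four_triangle A.
Proof.
move=> A3 clA; have /card_gt0P[x xA] : 0 < #|A| by rewrite A3.
have := cardsD1 x A; rewrite xA A3 => -[/esym A2].
have /cards2P[y [z [yz Ayz]]] : #|A :\ x| == 2 by apply/eqP.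
have [yA zA] : y \in A :\ x /\ z \in A :\ x by rewrite Ayz !inE !eqxx orbT.
move: yA zA; rewrite !inE => /andP[yx yA] /andP[zx zA].
have sumA (F : V -> nat) : \sum_(u in A) F u = F x + (F y + F z).
  by rewrite (big_setD1 x) //= Ayz big_setU1 ?inE //= big_set1.
rewrite !sumA !mu_loopless (mu_sym M y x) (mu_sym M z x) (mu_sym M z y) => ge8.
apply/four_triangleP; exists x, y, z; split; last by lia.
  by rewrite -(setD1K xA) Ayz setUA.
by rewrite !clA // eq_sym.
Qed.

(** Since 13 exceeds 3 * 4, some [x] sends at least 5 edges to [B]. It sends at most 6, so the other
    two vertices send at least 7, and some [y] receives 3 of them; [x] still sends at least 5 - 2 =
    3 to the rest of [B]. *)
Lemma exchange_four_triangles A B : #|A| = 3 -> #|B| = 3 -> clique A -> clique B ->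
  13 <= \sum_(x in A) \sum_(y in B) M x y ->
  exists x y, [/\ x \in A, y \in B, four_triangle (y |: A :\ x)
                & four_triangle (x |: B :\ y)].
Proof.
move=> A3 B3 clA clB ge13.
have [/exists_inP[x xA x5]|none] := boolP [exists x in A, 5 <= \sum_(y in B) M x y]; last first.
  have : \sum_(x in A) \sum_(y in B) M x y <= \sum_(x in A) 4.
    by apply: leq_sum => x xA; have := exists_inPn none x xA; rewrite -leqNgt.
  by rewrite sum_nat_const A3; lia.
have x6 : \sum_(y in B) M x y <= 6.
  by apply: (@leq_trans (\sum_(y in B) 2)); [exact: leq_sum|rewrite sum_nat_const B3].
have [/exists_inP[y yB y3]|none] :=
  boolP [exists y in B, 3 <= \sum_(z in A :\ x) M y z]; last first.
  have : \sum_(y in B) \sum_(z in A :\ x) M y z <= \sum_(y in B) 2.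
    by apply: leq_sum => y yB; have := exists_inPn none y yB; rewrite -leqNgt.
  rewrite sum_nat_const B3 exchange_big /=; move: ge13; rewrite (big_setD1 x) //=.
  under [X in _ + X]eq_bigr do under eq_bigr do rewrite mu_sym.
  by lia.
exists x, y; split=> //.
  apply: apex_four_triangle => //.
    by have := cardsD1 x A; rewrite xA A3 => -[].
  by move=> u v; rewrite !inE => /andP[_ uA] /andP[_ vA]; exact: clA.
apply: apex_four_triangle.
- by have := cardsD1 y B; rewrite yB B3 => -[].
- by move=> u v; rewrite !inE => /andP[_ uB] /andP[_ vB]; exact: clB.
by move: x5; rewrite (big_setD1 y) //=; have := stdM x y; lia.
Qed.

(** With [m] nonneighbours in [D], the degree into [D] is at most 2 * (3k - 1 - m); being at least
    4k - 1, it forces m < k. *)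
Lemma nonadjacent_lt D k x : x \in D -> #|D| = k * 3 ->
  4 * k <= (\sum_(y in D) M x y).+1 ->
  #|neighbors (fun x y => (x != y) && ~~ adjacent M x y) D x| < k.
Proof.
move=> xD cardD deg_x; set e := fun _ _ => _; set nonadj := neighbors e D x.
have xN : x \notin nonadj by rewrite !inE /e eqxx /= andbF.
have : \sum_(y in D) M x y + \sum_(y in D) 2 * (y \in x |: nonadj) <= \sum_(y in D) 2.
  rewrite -big_split; apply: leq_sum => y yD; have := stdM x y => xy2.
  rewrite !inE yD /e /adjacent (eq_sym y); have [<-|_] /= := eqVneq x y.
    by rewrite mu_loopless.
  by case: (posnP (M x y)) => [->|]; rewrite ?muln0 ?addn0 //= lt0n; case: eqP.
have sum_nonadj : \sum_(y in D) (y \in x |: nonadj) = #|nonadj|.+1.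
  have xD' : x |: nonadj \subset D.
    by apply/subsetP => y /setU1P[->//|]; rewrite inE => /andP[].
  have <- : #|x |: nonadj| = #|nonadj|.+1 by rewrite cardsU1 xN.
  rewrite -sum1_card [RHS](eq_bigl (fun y => (y \in D) && (y \in x |: nonadj))).
    by rewrite big_mkcondr; apply: eq_bigr => y _; case: (y \in _).
  by move=> y; case: (boolP (y \in _)) => [/(subsetP xD') ->|]; rewrite ?andbF.
rewrite -big_distrr /= sum_nonadj sum_nat_const cardD; move: deg_x; clear; lia.
Qed.

(** With k colours, the degrees of the class sum to at least 12k - 3, of which at most 7 stay
    inside. The remaining 12k - 10 exceed 12 for each of the k - 1 other classes. *)
Lemma dense_neighbor_class (C : finType) D (K : {set C}) (f : V -> C) c :
  {in D, forall x, f x \in K} -> c \in K -> #|color_class D f c| = 3 ->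
  clique (color_class D f c) -> ~~ four_triangle (color_class D f c) ->
  {in D, forall x, 4 * #|K| <= (\sum_(y in D) M x y).+1} ->
  exists d, [/\ d \in K, d != c
    & 13 <= \sum_(x in color_class D f c) \sum_(y in color_class D f d) M x y].
Proof.
move=> fK cK c3 clc badc degD; set A := color_class D f c.
have [/exists_inP[d dK /andP[dc ge13]]|none] := boolP [exists d in K, (d != c) &&
    (13 <= \sum_(x in A) \sum_(y in color_class D f d) M x y)].
  by exists d.
have low : #|A| * (4 * #|K|) <= \sum_(x in A) \sum_(y in D) M x y + #|A|.
  rewrite -sum_nat_const -[X in _ + X]sum1_card -big_split /=.
  by apply: leq_sum => x; rewrite inE addn1 => /andP[xD _]; exact: degD.
have splitD : \sum_(x in A) \sum_(y in D) M x y =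
    \sum_(d in K) \sum_(x in A) \sum_(y in color_class D f d) M x y.
  rewrite [RHS]exchange_big /=; apply: eq_bigr => x _.
  rewrite (partition_big f (mem K)) //=; apply: eq_bigr => d _.
  by apply: eq_bigl => y; rewrite inE.
have rest : \sum_(d in K :\ c) \sum_(x in A) \sum_(y in color_class D f d) M x y <=
    \sum_(d in K :\ c) 12.
  apply: leq_sum => d; rewrite inE in_set1 => /andP[dc dK].
  by have := exists_inPn none d dK; rewrite dc /= -leqNgt.
have : \sum_(x in A) \sum_(y in A) M x y <= 7.
  by rewrite -ltnS ltnNge; apply: contra badc; exact: heavy_clique.
move: low rest; rewrite splitD (big_setD1 c) //= sum_nat_const c3.
rewrite (cardsD1 c K) cK -/A.
by move: #|_ :\ _| (\sum_(_ in _ :\ _) _) (\sum_(_ in _) _); clear; lia.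
Qed.

Lemma improve_triangle_partition (C : finType) D (K : {set C}) (f : V -> C) :
  {in D, forall x, f x \in K} ->
  {in K, forall c, #|color_class D f c| = 3 /\ clique (color_class D f c)} ->
  {in D, forall x, 4 * #|K| <= (\sum_(y in D) M x y).+1} ->
  exists g, {in K, forall c, four_triangle (color_class D g c)}.
Proof.
move=> fK clf degD.
(* Each exchange makes the classes [c] and [d] 4-triangles and leaves the others alone, so the
   number of bad classes drops. *)
have [n] := ubnP #|[set c in K | ~~ four_triangle (color_class D f c)]|.
elim: n => // n IHn in f fK clf * => /ltnSE bad_n.
have [/exists_inP[c cK badc]|none] :=
  boolP [exists c in K, ~~ four_triangle (color_class D f c)]; last first.
  by exists f => c cK; have := exists_inPn none c cK; rewrite negbK.
have [c3 clc] := clf c cK.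
have [d [dK dc ge13]] := dense_neighbor_class fK cK c3 clc badc degD.
have [d3 cld] := clf d dK.
have [x [y [xc yd fourc fourd]]] := exchange_four_triangles c3 d3 clc cld ge13.
move: xc yd; rewrite !inE => /andP[xD /eqP fx] /andP[yD /eqP fy].
pose g := recolor (recolor f x d) y c.
have xy : x != y by apply: contraNneq dc => xy; rewrite -fx xy fy.
have gc : color_class D g c = y |: color_class D f c :\ x.
  apply/setP => v; rewrite !inE /g /recolor; have [->|vy] := eqVneq v y.
    by rewrite yD eqxx.
  by have [->|vx] := eqVneq v x; rewrite //= (negPf dc) andbF.
have gd : color_class D g d = x |: color_class D f d :\ y.
  apply/setP => v; rewrite !inE /g /recolor; have [->|vy] := eqVneq v y.
    by rewrite [c == d]eq_sym (negPf dc) andbF eq_sym (negPf xy).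
  by have [->|vx] := eqVneq v x; rewrite //= xD eqxx.
have gE u : u != c -> u != d -> color_class D g u = color_class D f u.
  move=> uc ud; apply/setP => v; rewrite !inE /g /recolor.
  have [->|vy] := eqVneq v y.
    by rewrite fy [c == u]eq_sym [d == u]eq_sym (negPf uc) (negPf ud).
  have [->|//] := eqVneq v x.
  by rewrite fx [c == u]eq_sym [d == u]eq_sym (negPf uc) (negPf ud).
apply: (IHn g).
- by move=> v vD; rewrite /g /recolor; do 2!case: ifP => // _; exact: fK.
- move=> u uK; have [->|uc] := eqVneq u c.
    by apply: four_triangle_clique; rewrite gc.
  have [->|ud] := eqVneq u d; first by apply: four_triangle_clique; rewrite gd.
  by rewrite gE //; exact: clf.
apply: leq_trans bad_n; apply/proper_card/properP; split.
  apply/subsetP => u; rewrite !in_set => /andP[uK]; rewrite uK.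
  have [->|uc] := eqVneq u c; first by rewrite gc fourc.
  by have [->|ud] := eqVneq u d; rewrite ?gd ?fourd // gE.
by exists c; rewrite !in_set cK //= gc fourc.
Qed.

Lemma four_triangle_partition (C : finType) (c0 : C) D (K : {set C}) :
  #|D| = #|K| * 3 -> {in D, forall x, 4 * #|K| <= (\sum_(y in D) M x y).+1} ->
  exists g, {in K, forall c, four_triangle (color_class D g c)}.
Proof.
(* Colour classes of the complement are cliques of the underlying graph. *)
move=> cardD degD; pose e x y := (x != y) && ~~ adjacent M x y.
have e_sym : symmetric e by move=> x y; rewrite /e eq_sym adjacent_sym.
have e_irr : irreflexive e by move=> x; rewrite /e eqxx.
have e_deg : {in D, forall x, #|neighbors e D x| < #|K|}.
  by move=> x xD; apply: nonadjacent_lt => //; exact: degD.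
have [f [fK fP fs]] := hajnal_szemeredi c0 e_sym e_irr cardD e_deg.
apply: (improve_triangle_partition fK) => // c cK; split; first exact: fs.
move=> x y; rewrite !inE => /andP[xD /eqP fx] /andP[yD /eqP fy] xy.
apply: contraT => Nxy; have exy : e x y by rewrite /e xy.
by have := fP x y xD yD exy; rewrite fx fy eqxx.
Qed.

Lemma disjoint_four_triangles (C : finType) D (K : {set C}) (f : V -> C) :
  {in K, forall c, contains_4triangle_on M (color_class D f c)} ->
  contains_disjoint_4triangles M #|K|.
Proof.
move=> fourf; exists [set color_class D f c | c in K]; split.
- apply: card_in_imset => c d cK dK /setP cd.
  have [x [y [z [cE _ _]]]] := fourf c cK.
  have xc : x \in color_class D f c by rewrite cE !inE eqxx.
  move: (cd x); rewrite xc; move: xc; rewrite !inE => /andP[-> /eqP ->].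
  by move/esym/eqP.
- apply/trivIsetP => _ _ /imsetP[c cK ->] /imsetP[d dK ->] cd.
  rewrite -setI_eq0; apply/eqP/setP => x; rewrite !inE.
  apply/negP => /andP[/andP[_ /eqP fc] /andP[_ /eqP fd]].
  by rewrite -fc -fd eqxx in cd.
- by move=> _ /imsetP[c cK ->]; exact: fourf.
Qed.

Lemma min_degree_le x : min_degree M <= degree M x.
Proof.
rewrite /min_degree; set d := \max_(_ : V) _; have : x \in index_enum V by rewrite mem_index_enum.
elim: (index_enum V) d => // y l IHl d; rewrite inE big_cons /= => /predU1P[<-|xl].
  exact: geq_minl.
exact: leq_trans (geq_minr _ _) (IHl d xl).
Qed.

End FourTriangles.

(** * Adding a vertex doubly joined to all others *)

Section DominatingVertex.

Variables (V : finType) (M : multigraph V).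

Definition cone_mu (u v : option V) : nat :=
  match u, v with
  | Some x, Some y => M x y
  | None, None => 0
  | _, _ => 2
  end.

Lemma cone_mu_sym u v : cone_mu u v = cone_mu v u.
Proof. by case: u v => [x|] [y|] //=; rewrite mu_sym. Qed.

Lemma cone_mu_loopless u : cone_mu u u = 0.
Proof. by case: u => [x|] //=; rewrite mu_loopless. Qed.

Definition cone : multigraph (option V) := Multigraph cone_mu_sym cone_mu_loopless.

Lemma cone_standard : standard M -> standard cone.
Proof. by move=> stdM [x|] [y|] /=. Qed.

Lemma sum_option (F : option V -> nat) : \sum_u F u = F None + \sum_x F (Some x).
Proof.
rewrite (bigD1 None) //=; congr (_ + _).
rewrite (reindex_omap Some id) /=; last by case.
by apply: eq_bigl => x; rewrite eqxx.
Qed.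

(** Only the class containing the added vertex [None] is lost; the other [k] classes live in [M]. *)
Lemma cone_disjoint_four_triangles k (f : option V -> 'I_k.+1) :
  (forall c, contains_4triangle_on cone (color_class setT f c)) ->
  contains_disjoint_4triangles M k.
Proof.
move=> fourf; have <- : #|[set~ f None]| = k by rewrite cardsC1 card_ord.
apply: (@disjoint_four_triangles _ _ _ setT _ (f \o Some)) => c; rewrite !inE => cN.
have [u [v [w [cE adj ge4]]]] := fourf c.
have notNone t : t \in color_class setT f c -> exists x, t = Some x.
  by case: t => [x _|]; [exists x | rewrite !inE /= eq_sym (negPf cN)].
have [x ux] : exists x, u = Some x by apply: notNone; rewrite cE !inE eqxx.
have [y vy] : exists y, v = Some y by apply: notNone; rewrite cE !inE eqxx orbT.
have [z wz] : exists z, w = Some z by apply: notNone; rewrite cE !inE eqxx orbT.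
subst u v w; exists x, y, z; split=> //.
by apply/setP => t; move/setP: cE => /(_ (Some t)); rewrite !inE.
Qed.

End DominatingVertex.

(** * Reduction to a vertex number divisible by 3 *)

Local Open Scope ring_scope.

Theorem theorem11 (n : nat) (V : finType) (M : multigraph V)
    (cardV : #|V| = n) (stdM : standard M)
    (minM : (4 * n%:R - 3) / 3 <= (min_degree M)%:R :> rat) :
  contains_disjoint_4triangles M (n %/ 3)%N.
Proof.
have deg x : (4 * n <= 3 * degree M x + 3)%N.
  apply: (@leq_trans (3 * min_degree M + 3)); last by rewrite leq_add2r leq_mul2l min_degree_le.
  move: minM; rewrite ler_pdivrMr // lerBlDr -!natrM -natrD ler_nat.
  by rewrite mulnC [X in (_ <= X + _)%N]mulnC.
have [r2|r2] := eqVneq (n %% 3)%N 2%N.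
  (* Degrees are at least 4k + 2 by integrality, hence at least 4k + 4 in the cone, which has 3 * (k
     + 1) vertices. *)
  set k := (n %/ 3)%N; have nE : n = (3 * k + 2)%N by lia.
  have [|u _|f four_f] := @four_triangle_partition _ (cone M) (cone_standard stdM) _
    (ord0 : 'I_k.+1) setT setT.
  - by rewrite !cardsT card_ord card_option cardV; lia.
  - rewrite cardsT card_ord; under eq_bigl do rewrite in_setT.
    rewrite sum_option; case: u => [x|] /=.
      by have := deg x; rewrite /degree; lia.
    by rewrite sum_nat_const cardV; lia.
  apply: (@cone_disjoint_four_triangles _ _ _ f) => c.
  by apply/four_triangleP/four_f; rewrite in_setT.
(* At most one vertex is discarded. If n = 3k, degrees are at least 4k - 1; if n = 3k + 1, they are
   at least 4k + 1 and drop by at most 2. *)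
set k := (n %/ 3)%N; pose D : {set V} := [set x in take (k * 3) (enum V)].
have cardD : #|D| = (k * 3)%N.
  rewrite cardsE (card_uniqP _) ?take_uniq ?enum_uniq // size_takel //.
  by rewrite -cardE cardV; lia.
(* The [k] colours are taken inside ['I_k.+1], which is inhabited even for [k = 0]. *)
have cardK : #|[set~ (ord0 : 'I_k.+1)]| = k by rewrite cardsC1 card_ord.
have [|x xD|f four_f] := @four_triangle_partition _ _ stdM _ (ord0 : 'I_k.+1) D [set~ ord0].
- by rewrite cardD cardK.
- have := deg x; rewrite cardK /degree (bigID (mem D)) /=.
  have : (\sum_(y in ~: D) M x y <= \sum_(y in ~: D) 2)%N by apply: leq_sum.
  rewrite sum_nat_const; have := cardsC D; rewrite cardD cardV.
  have -> : (\sum_(y in ~: D) M x y = \sum_(y | y \notin D) M x y)%N.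
    by apply: eq_bigl => y; rewrite inE.
  move: r2; move: (\sum_(y | _) _)%N (\sum_(y in D) _)%N #|~: D|; rewrite /k; clear.
  by move=> R S m; lia.
rewrite -[X in contains_disjoint_4triangles _ X]cardK.
apply: (@disjoint_four_triangles _ _ _ D _ f) => c cK.
exact/four_triangleP/four_f.
Qed.
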